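(* Let $\mathbf{A}\in\mathbb{H}^{m\times n}_{r_1}$ and $\mathbf{B}\in\mathbb{H}^{m\times m}$, and let $\mathbf{X}=\mathbf{A}^\dagger\mathbf{B}\big(\mathbf{I}-\tfrac12\mathbf{Q}_A\big)=(x_{ij})\in\mathbb{H}^{n\times m}$. Let $\mathbf{b}^{(1)}_{.j}$ be the $j$th column of $\mathbf{B}_1=\mathbf{A}^*\mathbf{B}$, and $\mathbf{b}^{(2)}_{.k}$, $\mathbf{b}^{(2)}_{l.}$ the $k$th column and $l$th row of $\mathbf{B}_2=\mathbf{A}^*\mathbf{B}\mathbf{A}\mathbf{A}^*\in\mathbb{H}^{n\times m}$. Define the row vector $\mathbf{d}_{i.}\in\mathbb{H}^{1\times m}$ with $k$th entry $\sum_{\beta\in J_{r_1,n}\{i\}}\mathrm{cdet}_i\big((\mathbf{A}^*\mathbf{A})_{.i}(\mathbf{b}^{(2)}_{.k})\big)^\beta_\beta$ ($k=1,\dots,m$) and the column vector $\mathbf{d}_{.j}\in\mathbb{H}^{n\times1}$ with $l$th entry $\sum_{\alpha\in I_{r_1,m}\{j\}}\mathrm{rdet}_j\big((\mathbf{A}\mathbf{A}^* )_{j.}(\mathbf{b}^{(2)}_{l.})\big)^\alpha_\alpha$ ($l=1,\dots,n$). Then $$x_{ij}=\frac{\sum_{\beta\in J_{r_1,n}\{i\}}\mathrm{cdet}_i\big((\mathbf{A}^*\mathbf{A})_{.i}(\mathbf{b}^{(1)}_{.j})\big)^\beta_\beta}{\sum_{\beta\in J_{r_1,n}}|\mathbf{A}^*\mathbf{A}|^\beta_\beta}-\frac{\sum_{\alpha\in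 I_{r_1,m}\{j\}}\mathrm{rdet}_j\big((\mathbf{A}\mathbf{A}^* )_{j.}(\mathbf{d}_{i.})\big)^\alpha_\alpha}{2\sum_{\beta\in J_{r_1,n}}|\mathbf{A}^*\mathbf{A}|^\beta_\beta\sum_{\alpha\in I_{r_1,m}}|\mathbf{A}\mathbf{A}^*|^\alpha_\alpha},$$ and also $$x_{ij}=\frac{\sum_{\beta\in J_{r_1,n}\{i\}}\mathrm{cdet}_i\big((\mathbf{A}^*\mathbf{A})_{.i}(\mathbf{b}^{(1)}_{.j})\big)^\beta_\beta}{\sum_{\beta\in J_{r_1,n}}|\mathbf{A}^*\mathbf{A}|^\beta_\beta}-\frac{\sum_{\beta\in J_{r_1,n}\{i\}}\mathrm{cdet}_i\big((\mathbf{A}^*\mathbf{A})_{.i}(\mathbf{d}_{.j})\big)^\beta_\beta}{2\sum_{\beta\in J_{r_1,n}}|\mathbf{A}^*\mathbf{A}|^\beta_\beta\sum_{\alpha\in I_{r_1,m}}|\mathbf{A}\mathbf{A}^*|^\alpha_\alpha}.$$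
   Context: $\mathbb{H}$ is the skew field of real quaternions; $\mathbb{H}^{m\times n}$ is the set of $m\times n$ matrices over $\mathbb{H}$ and $\mathbb{H}^{m\times n}_r$ the subset of those of rank $r$. $\mathbf{A}^*$ is the conjugate transpose and $\mathbf{A}^\dagger$ the Moore–Penrose inverse (the unique $\mathbf{X}$ with $\mathbf{AXA}=\mathbf{A}$, $\mathbf{XAX}=\mathbf{X}$, $(\mathbf{AX})^*=\mathbf{AX}$, $(\mathbf{XA})^*=\mathbf{XA}$). $\mathbf{Q}_A=\mathbf{A}\mathbf{A}^\dagger$. For a matrix $\mathbf{F}$, $\mathbf{F}_{.j}(\mathbf{b})$ (resp. $\mathbf{F}_{i.}(\mathbf{b})$) is $\mathbf{F}$ with its $j$th column (resp. $i$th row) replaced by the column (resp. row) $\mathbf{b}$. Row/column determinants: for $\mathbf{F}=(a_{ij})\in\mathbb{H}^{n\times n}$, $\mathrm{rdet}_i\mathbf{F}=\sum_{\sigma\in S_n}(-1)^{n-r}(a_{i\,i_{k_1}}a_{i_{k_1}i_{k_1+1}}\cdots a_{i_{k_1+l_1}i})\cdots(a_{i_{k_r}i_{k_r+1}}\cdots a_{i_{k_r+l_r}i_{k_r}})$, where $\sigma=(i\,i_{k_1}\,i_{k_1+1}\cdots i_{k_1+l_1})(i_{k_2}\cdots i_{k_2+l_2})\cdots(i_{k_r}\cdots i_{k_r+l_r})$ is the decomposition of $\sigma$ into $r$ disjoint cycles (fixed points included) with $i_{k_2}<\cdots<i_{k_r}$ and $i_{k_t}<i_{k_t+s}$ for $t=2,\dots,r$,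 $s=1,\dots,l_t$; and $\mathrm{cdet}_j\mathbf{F}=\sum_{\tau\in S_n}(-1)^{n-r}(a_{j_{k_r}j_{k_r+l_r}}\cdots a_{j_{k_r+1}j_{k_r}})\cdots(a_{j\,j_{k_1+l_1}}\cdots a_{j_{k_1+1}j_{k_1}}a_{j_{k_1}j})$, where $\tau=(j_{k_r+l_r}\cdots j_{k_r+1}\,j_{k_r})\cdots(j_{k_2+l_2}\cdots j_{k_2})(j_{k_1+l_1}\cdots j_{k_1+1}\,j_{k_1}\,j)$ is the decomposition into $r$ disjoint cycles with $j_{k_2}<\cdots<j_{k_r}$ and $j_{k_t}<j_{k_t+s}$ for $t=2,\dots,r$, $s=1,\dots,l_t$. For Hermitian $\mathbf{F}$ all these coincide and are real; this value is $\det\mathbf{F}$. Index sets: $L_{k,n}$ is the set of strictly increasing sequences $\alpha=(\alpha_1<\cdots<\alpha_k)$ in $\{1,\dots,n\}$; $I_{k,m}\{i\}=\{\alpha\in L_{k,m}: i\in\alpha\}$, $J_{k,n}\{j\}=\{\beta\in L_{k,n}: j\in\beta\}$; sums over $J_{k,n}$ or $I_{k,m}$ without braces run over all of $L_{k,n}$, $L_{k,m}$. For a square $\mathbf{F}$, $\mathbf{F}^\alpha_\alpha$ is the principal submatrix with rows and columns indexed by $\alpha$; $\mathrm{cdet}_i(\mathbf{G})^\beta_\beta$ (resp. $\mathrm{rdet}_j(\mathbf{G})^\alpha_\alpha$) is the column (resp. row) determinant of the principal submatrix $\mathbf{G}^\beta_\beta$ taken at the column (resp. row) coming from index $i$ (resp.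 $j$); for Hermitian $\mathbf{F}$, $|\mathbf{F}|^\alpha_\alpha=\det\mathbf{F}^\alpha_\alpha$. *)

(* Defs.v *)
From HB Require Import structures.
From mathcomp Require Export all_boot all_order all_algebra all_fingroup.
From mathcomp Require Import ring lra.
From mathcomp Require Export reals.
Set Implicit Arguments. Unset Strict Implicit. Unset Printing Implicit Defensive.
Import Order.TTheory GRing.Theory Num.Theory.
Local Open Scope ring_scope.

Section Quaternion.
Variable R : realFieldType.

Record quat := Quat { q0 : R; q1 : R; q2 : R; q3 : R }.

Definition quat_code (x : quat) := (q0 x, q1 x, q2 x, q3 x).
Definition quat_decode (p : R * R * R * R) := Quat p.1.1.1 p.1.1.2 p.1.2 p.2.
Lemma quat_codeK : cancel quat_code quat_decode. Proof. by case. Qed.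

HB.instance Definition _ := Equality.copy quat (can_type quat_codeK).
HB.instance Definition _ := Choice.copy quat (can_type quat_codeK).

Definition qadd x y := Quat (q0 x + q0 y) (q1 x + q1 y) (q2 x + q2 y) (q3 x + q3 y).
Definition qopp x := Quat (- q0 x) (- q1 x) (- q2 x) (- q3 x).
Definition qzero := Quat 0 0 0 0.

Lemma qaddA : associative qadd.
Proof. by move=> [a b c d] [e f g h] [i j k l]; rewrite /qadd /=; congr Quat; ring. Qed.
Lemma qaddC : commutative qadd.
Proof. by move=> [a b c d] [e f g h]; rewrite /qadd /=; congr Quat; ring. Qed.
Lemma qadd0 : left_id qzero qadd.
Proof. by move=> [a b c d]; rewrite /qadd /=; congr Quat; ring. Qed.
Lemma qaddN : left_inverse qzero qopp qadd.
Proof. by move=> [a b c d]; rewrite /qadd /=; congr Quat; ring. Qed.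

HB.instance Definition _ := GRing.isZmodule.Build quat qaddA qaddC qadd0 qaddN.

Definition qmul x y :=
  Quat (q0 x * q0 y - q1 x * q1 y - q2 x * q2 y - q3 x * q3 y)
       (q0 x * q1 y + q1 x * q0 y + q2 x * q3 y - q3 x * q2 y)
       (q0 x * q2 y - q1 x * q3 y + q2 x * q0 y + q3 x * q1 y)
       (q0 x * q3 y + q1 x * q2 y - q2 x * q1 y + q3 x * q0 y).
Definition qone := Quat 1 0 0 0.

Lemma qmulA : associative qmul.
Proof. by move=> [a b c d] [e f g h] [i j k l]; rewrite /qmul /=; congr Quat; ring. Qed.
Lemma qmul1 : left_id qone qmul.
Proof. by move=> [a b c d]; rewrite /qmul /=; congr Quat; ring. Qed.
Lemma qmulr1 : right_id qone qmul.
Proof. by move=> [a b c d]; rewrite /qmul /=; congr Quat; ring. Qed.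
Lemma qmulDl : left_distributive qmul qadd.
Proof. by move=> [a b c d] [e f g h] [i j k l]; rewrite /qmul /qadd /=; congr Quat; ring. Qed.
Lemma qmulDr : right_distributive qmul qadd.
Proof. by move=> [a b c d] [e f g h] [i j k l]; rewrite /qmul /qadd /=; congr Quat; ring. Qed.
Lemma qone_neq0 : qone != qzero.
Proof. by apply/eqP => -[] /eqP; rewrite oner_eq0. Qed.

HB.instance Definition _ := GRing.Zmodule_isNzRing.Build quat
  qmulA qmul1 qmulr1 qmulDl qmulDr qone_neq0.

Definition qnorm2 x := q0 x ^+ 2 + q1 x ^+ 2 + q2 x ^+ 2 + q3 x ^+ 2.
Definition qinv x := let n := (qnorm2 x)^-1 in
  Quat (q0 x * n) (- q1 x * n) (- q2 x * n) (- q3 x * n).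
Definition qunit := [pred x : quat | x != 0].

Lemma qnorm2_eq0 x : (qnorm2 x == 0) = (x == 0).
Proof.
case: x => a b c d; rewrite /qnorm2 /=.
rewrite !paddr_eq0 ?addr_ge0 ?sqr_ge0 // !sqrf_eq0.
apply/idP/eqP => [/andP[/andP[/andP[/eqP-> /eqP->] /eqP->] /eqP->] //|[-> -> -> ->]].
by rewrite !eqxx.
Qed.

Lemma qmulV : {in qunit, left_inverse 1 qinv *%R}.
Proof.
move=> x; rewrite inE -qnorm2_eq0; case: x => a b c d /=.
rewrite /qnorm2 /= => nz; rewrite /GRing.mul /= /qmul /qinv /=.
by congr Quat; rewrite /qnorm2 /=; field.
Qed.
Lemma qdivrr : {in qunit, right_inverse 1 qinv *%R}.
Proof.
move=> x; rewrite inE -qnorm2_eq0; case: x => a b c d /=.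
rewrite /qnorm2 /= => nz; rewrite /GRing.mul /= /qmul /qinv /=.
by congr Quat; rewrite /qnorm2 /=; field.
Qed.
Lemma qunitP : forall x y : quat, y * x = 1 /\ x * y = 1 -> qunit x.
Proof.
move=> x y [yx _]; rewrite inE; apply/eqP => x0; move: yx; rewrite x0 mulr0.
by move/eqP; rewrite eq_sym oner_eq0.
Qed.
Lemma qinv_out : {in [predC qunit], qinv =1 id}.
Proof.
move=> x; rewrite !inE negbK => /eqP->.
by rewrite /qinv /qnorm2 /= oppr0 !mul0r.
Qed.

HB.instance Definition _ := GRing.NzRing_hasMulInverse.Build quat
  qmulV qdivrr qunitP qinv_out.

End Quaternion.

Section QMatrix.
Variable R : realFieldType.
Local Notation H := (quat R).

Definition qconj (x : H) : H := Quat (q0 x) (- q1 x) (- q2 x) (- q3 x).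
Definition cadj m n (A : 'M[H]_(m, n)) : 'M[H]_(n, m) := \matrix_(i, j) qconj (A j i).

Definition is_MP_inverse m n (A : 'M[H]_(m, n)) (X : 'M[H]_(n, m)) : Prop :=
  [/\ A *m X *m A = A, X *m A *m X = X,
      cadj (A *m X) = A *m X & cadj (X *m A) = X *m A].

Definition col_indep m n (A : 'M[H]_(m, n)) (S : {set 'I_n}) : Prop :=
  forall c : 'cV[H]_n, (forall j, j \notin S -> c j 0 = 0) -> A *m c = 0 -> c = 0.

Definition has_rank m n (A : 'M[H]_(m, n)) (r : nat) : Prop :=
  (exists S : {set 'I_n}, #|S| = r /\ col_indep A S) /\
  (forall S : {set 'I_n}, col_indep A S -> (#|S| <= r)%N).

Definition col_repl p q (F : 'M[H]_(p, q)) (j : 'I_q) (b : 'cV[H]_p) : 'M[H]_(p, q) :=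
  \matrix_(x, y) if y == j then b x 0 else F x y.
Definition row_repl p q (F : 'M[H]_(p, q)) (i : 'I_p) (b : 'rV[H]_q) : 'M[H]_(p, q) :=
  \matrix_(x, y) if x == i then b 0 y else F x y.

Definition cyc_prod k (F : 'M[H]_k) (s : {perm 'I_k}) (h : 'I_k) : H :=
  \prod_(t < #|porbit s h|) F ((s ^+ t)%g h) ((s ^+ t.+1)%g h).
Definition cyc_min k (s : {perm 'I_k}) (h : 'I_k) : bool :=
  [forall x in porbit s h, (h <= x)%N].
Definition cyc_sign k (s : {perm 'I_k}) : H := (-1) ^+ (k - #|porbits s|).

Definition rdet k (F : 'M[H]_k) (i : 'I_k) : H :=
  \sum_(s : {perm 'I_k}) cyc_sign s *
    (cyc_prod F s i *
     \prod_(h <- enum 'I_k | (h \notin porbit s i) && cyc_min s h) cyc_prod F s h).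

Definition cdet k (F : 'M[H]_k) (j : 'I_k) : H :=
  \sum_(s : {perm 'I_k}) cyc_sign s *
    (\prod_(h <- rev (enum 'I_k) | (h \notin porbit s j) && cyc_min s h) cyc_prod F s h *
     cyc_prod F s j).

(* determinant of a Hermitian matrix: the common value of all rdet_i / cdet_j,
   here written as the row determinant with all cycles ordered by increasing
   least element (= rdet_1 for k > 0; = 1 for k = 0) *)
Definition hdet k (F : 'M[H]_k) : H :=
  \sum_(s : {perm 'I_k}) cyc_sign s *
    \prod_(h <- enum 'I_k | cyc_min s h) cyc_prod F s h.

Definition incr n k (b : k.-tuple 'I_n) : bool :=
  sorted (fun x y : 'I_n => (x < y)%N) b.

Definition psub n k (F : 'M[H]_n) (b : k.-tuple 'I_n) : 'M[H]_k :=
  \matrix_(x, y) F (tnth b x) (tnth b y).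

(* sum_{b in J_{k,n}{i}} cdet_i (F)^b_b ; the column of F^b_b coming from i is
   the position a with tnth b a = i (unique since b is strictly increasing) *)
Definition sum_cdet n k (F : 'M[H]_n) (i : 'I_n) : H :=
  \sum_(b : k.-tuple 'I_n | incr b && (i \in b))
    \sum_(a < k | tnth b a == i) cdet (psub F b) a.

Definition sum_rdet n k (F : 'M[H]_n) (j : 'I_n) : H :=
  \sum_(b : k.-tuple 'I_n | incr b && (j \in b))
    \sum_(a < k | tnth b a == j) rdet (psub F b) a.

Definition sum_hdet n k (F : 'M[H]_n) : H :=
  \sum_(b : k.-tuple 'I_n | incr b) hdet (psub F b).

End QMatrix.

(* Main.v *)
(** For a Hermitian quaternion matrix [G] put [D S] for the Moore determinant of
   the principal submatrix on [S].  Removing the first edge of the cycle through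
   a distinguished index turns row determinants into signed sums over simple
   paths, weighted by [D] of the unused indices.  In that form, reversal of
   paths and cyclicity of the real part show that [D S] is real, does not depend
   on the row chosen for the expansion, and that a repeated row gives [0].

   Summing over all [S] of size [k] one gets matrices [K_k] and real scalars
   [d_k] with [G K_k + K_(k+1) = d_k I], and the sums of row determinants in the
   theorem are the entries of [c K_k].  When [d_k = 0] for [k > r], descending
   induction gives [G K_r = d_r P] with [P] the orthogonal projection on the
   range of [G]; this is the determinantal formula for the Moore-Penrose
   inverse.  For a Gram matrix [A^* A], [D S > 0] when the columns of [A] indexed
   by [S] are independent and [D S = 0] otherwise, so [r] is the rank of [A].
   Taking traces, [r] is also the real trace of [P], and so the same for [A] and
   [A^*].  Column determinants are conjugates of row determinants of the
   adjoint. *)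

Require Import Defs.
From HB Require Import structures.
From mathcomp Require Import all_boot all_order all_algebra.
From mathcomp Require Import reals.
From mathcomp Require Import ring lra zify.
Import Order.TTheory GRing.Theory Num.Theory.
Local Open Scope ring_scope.

Set Implicit Arguments.
Unset Strict Implicit.
Unset Printing Implicit Defensive.

(** * Quaternions and path sums *)

Section Quat.
Variable R : realFieldType.
Implicit Types x y : quat R.

Definition qreal x := qconj x = x.

Lemma qconjK : involutive (@qconj R).
Proof. by case=> a b c d; rewrite /qconj /= !opprK. Qed.

Lemma qconjD x y : qconj (x + y) = qconj x + qconj y.
Proof. by rewrite /qconj /GRing.add /= /qadd /= !opprD. Qed.

Lemma qconj0 : qconj (0 : quat R) = 0.
Proof. by rewrite /qconj /GRing.zero /= /qzero /= oppr0. Qed.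

Lemma qconjN x : qconj (- x) = - qconj x.
Proof. by []. Qed.

Lemma qconj1 : qconj (1 : quat R) = 1.
Proof. by rewrite /qconj /GRing.one /= /qone /= oppr0. Qed.

Lemma qconjM x y : qconj (x * y) = qconj y * qconj x.
Proof.
case: x y => a b c d [e f g h].
rewrite /qconj /GRing.mul /= /qmul /=.
by congr Quat; ring.
Qed.

Lemma qconj_sum I (r : seq I) (P : pred I) (E : I -> quat R) :
  qconj (\sum_(i <- r | P i) E i) = \sum_(i <- r | P i) qconj (E i).
Proof. exact: (big_morph _ qconjD qconj0). Qed.

Lemma q0_sum I (r : seq I) (P : pred I) (E : I -> quat R) :
  q0 (\sum_(i <- r | P i) E i) = \sum_(i <- r | P i) q0 (E i).
Proof. exact: (big_morph (@q0 R) (fun x y => erefl) erefl). Qed.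

Lemma q0B x y : q0 (x - y) = q0 x - q0 y.
Proof. by []. Qed.

Lemma q0M x y : q0 (x * y) = q0 (y * x).
Proof. by case: x y => a b c d [e f g h]; rewrite /GRing.mul /=; ring. Qed.

Lemma qrealE x : qreal x -> x = Quat (q0 x) 0 0 0.
Proof.
by case: x => a b c d [] /= hb hc hd; congr Quat; lra.
Qed.

Lemma qrealC x y : qreal x -> x * y = y * x.
Proof.
move/qrealE ->; case: y => e f g h; rewrite /GRing.mul /= /qmul /=.
by congr Quat; ring.
Qed.

Lemma qreal_q0_inj x y : qreal x -> qreal y -> q0 x = q0 y -> x = y.
Proof. by move=> /qrealE -> /qrealE -> /= ->. Qed.

Lemma qconjMl x : qconj x * x = Quat (qnorm2 x) 0 0 0.
Proof.
case: x => a b c d; rewrite /qconj /GRing.mul /= /qmul /qnorm2 /=.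
by congr Quat; ring.
Qed.

Lemma qnorm2_ge0 x : 0 <= qnorm2 x.
Proof. by rewrite /qnorm2 !addr_ge0 ?sqr_ge0. Qed.

(** Testing with [q = qconj (x - y)] gives the squared norm. Quaternion identities thus reduce to
    real parts, where [q0M] permutes factors cyclically. *)
Lemma q0_nondegenerate x y : (forall q, q0 (q * x) = q0 (q * y)) -> x = y.
Proof.
move=> h; apply/eqP; rewrite -subr_eq0 -qnorm2_eq0; apply/eqP.
have -> : qnorm2 (x - y) = q0 (qconj (x - y) * (x - y)) by rewrite qconjMl.
by rewrite mulrBr q0B h subrr.
Qed.

Lemma qreal0 : qreal 0. Proof. exact: qconj0. Qed.
Lemma qreal1 : qreal 1. Proof. exact: qconj1. Qed.

Lemma qreal_sum I (r : seq I) (P : pred I) (E : I -> quat R) :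
  (forall i, P i -> qreal (E i)) -> qreal (\sum_(i <- r | P i) E i).
Proof. by move=> h; rewrite /qreal qconj_sum; apply: eq_bigr. Qed.

Lemma qrealM x y : qreal x -> qreal y -> qreal (x * y).
Proof. by move=> hx hy; rewrite /qreal qconjM hx hy (qrealC _ hx). Qed.

End Quat.

Section PathSum.
Variables (R : realFieldType) (T : finType).
Local Notation H := (quat R).
Variable F : T -> T -> H.
Implicit Types (g : {set T} -> H) (S U : {set T}) (x y z a b i j : T).

(* [path_sum g S x y] is the sum over simple paths x -> x1 -> ... -> xk -> y with
   interior in [S] of (-1)^k F x x1 ... F xk y * g (S minus the interior); the
   fuel of the recursion is [#|S|]. *)
Fixpoint path_sum_rec N g S x y : H :=
  F x y * g S -
  if N is N'.+1 then \sum_(z in S) F x z * path_sum_rec N' g (S :\ z) z y else 0.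

Definition path_sum g S x y := path_sum_rec #|S| g S x y.

Lemma path_sumE g S x y :
  path_sum g S x y =
  F x y * g S - \sum_(z in S) F x z * path_sum g (S :\ z) z y.
Proof.
rewrite {1}/path_sum; case E: #|S| => [|N] /=.
  by move/eqP: E; rewrite cards_eq0 => /eqP ->; rewrite big_set0.
congr (_ - _); apply: eq_bigr => z zS; rewrite /path_sum.
by have := cardsD1 z S; rewrite zS E add1n => -[] <-.
Qed.

Lemma set_ind (P : {set T} -> Prop) :
  (forall S, (forall U, (#|U| < #|S|)%N -> P U) -> P S) -> forall S, P S.
Proof.
move=> h S; have [N] := ubnP #|S|.
elim: N S => // N IH S lS; apply: h => U lU; apply: IH.
exact: leq_trans lU _.
Qed.

Lemma cardsD1_lt {z S} : z \in S -> (#|S :\ z| < #|S|)%N.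
Proof. by move=> zS; rewrite [X in (_ < X)%N](cardsD1 z) zS. Qed.

Lemma setD1C S z w : S :\ z :\ w = S :\ w :\ z.
Proof. by rewrite !setDDl setUC. Qed.

Lemma path_sum_eq g1 g2 S x y :
  (forall U, U \subset S -> g1 U = g2 U) -> path_sum g1 S x y = path_sum g2 S x y.
Proof.
elim/set_ind: S x y => S IH x y h; rewrite !path_sumE h //.
congr (_ - _); apply: eq_bigr => z zS; rewrite IH ?cardsD1_lt // => U sU.
by apply: h; apply: subset_trans sU (subsetDl _ _).
Qed.

Lemma path_sumMr g S x y q :
  path_sum (fun U => g U * q) S x y = path_sum g S x y * q.
Proof.
elim/set_ind: S x y => S IH x y; rewrite !path_sumE mulrBl mulrA.
congr (_ - _); rewrite mulr_suml; apply: eq_bigr => z zS.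
by rewrite IH ?cardsD1_lt // mulrA.
Qed.

Lemma path_sumB g1 g2 S x y :
  path_sum (fun U => g1 U - g2 U) S x y = path_sum g1 S x y - path_sum g2 S x y.
Proof.
elim/set_ind: S x y => S IH x y; rewrite !path_sumE mulrBr.
rewrite [in RHS]opprD [RHS]addrACA -[in RHS]opprD; congr (_ - _).
rewrite -sumrB; apply: eq_bigr => z zS.
by rewrite IH ?cardsD1_lt // mulrBr.
Qed.

Lemma exchange_setD1 S (E : T -> T -> H) :
  \sum_(z in S) \sum_(w in S :\ z) E z w = \sum_(w in S) \sum_(z in S :\ w) E z w.
Proof.
rewrite (exchange_big_dep (fun w => w \in S)) /=; last first.
  by move=> z w _; rewrite in_setD1 => /andP[].
apply: eq_bigr => w wS; apply: eq_bigl => z.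
by rewrite !in_setD1 wS andbT andbC eq_sym.
Qed.

Lemma path_sum_extract (h : T -> {set T} -> H) S x y :
  path_sum (fun U => \sum_(z in U) h z (U :\ z)) S x y =
  \sum_(z in S) path_sum (h z) (S :\ z) x y.
Proof.
elim/set_ind: S x y => S IH x y; rewrite path_sumE mulr_sumr.
under [RHS]eq_bigr do rewrite path_sumE.
rewrite sumrB; congr (_ - _).
rewrite [RHS]exchange_setD1; apply: eq_bigr => w wS.
rewrite IH ?cardsD1_lt // mulr_sumr; apply: eq_bigr => z _.
by rewrite setD1C.
Qed.

(** Expansion along the last edge; real weights are central, so they may stand at either end of the
    product. *)
Lemma path_sumEr g S x y : (forall U, U \subset S -> qreal (g U)) ->
  path_sum g S x y =
  g S * F x y - \sum_(z in S) path_sum g (S :\ z) x z * F z y.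
Proof.
elim/set_ind: S x y => S IH x y h; rewrite path_sumE (qrealC (F x y) (h S _)) //.
congr (_ - _).
have hD z U : U \subset S :\ z -> qreal (g U).
  by move=> sU; apply: h; apply: subset_trans sU (subsetDl _ _).
transitivity (\sum_(z in S) (F x z * g (S :\ z) * F z y) -
   \sum_(z in S) \sum_(w in S :\ z) F x z * path_sum g (S :\ z :\ w) z w * F w y).
  rewrite -sumrB; apply: eq_bigr => z zS.
  rewrite IH ?cardsD1_lt //; last exact: hD.
  rewrite mulrBr mulrA; congr (_ - _).
  by rewrite mulr_sumr; apply: eq_bigr => w _; rewrite mulrA.
rewrite exchange_setD1 -sumrB; apply: eq_bigr => z zS.
rewrite [in RHS]path_sumE mulrBl; congr (_ - _).
rewrite mulr_suml; apply: eq_bigr => w _.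
by rewrite setD1C.
Qed.

(** Both sides run over the same pairs of paths with disjoint interiors, and cyclicity of the real
    part exchanges the two products. The coefficients are arbitrary so that the induction can absorb
    a removed edge into [q']. *)
Lemma path_sum_swap g S x y a b q q' : (forall U, qreal (g U)) ->
  q0 (q' * path_sum (fun U => q * path_sum g U a b) S x y) =
  q0 (q * path_sum (fun U => q' * path_sum g U x y) S a b).
Proof.
move=> hg; elim/set_ind: S x y a b q q' => S IH x y a b q q'.
rewrite path_sumE mulrBr mulr_sumr q0B q0_sum.
transitivity (q0 (q' * (F x y * (q * path_sum g S a b))) - \sum_(z in S)
    q0 (q * path_sum (fun U => q' * F x z * path_sum g U z y) (S :\ z) a b)).
  congr (_ - _); apply: eq_bigr => z zS.
  by rewrite mulrA IH ?cardsD1_lt.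
rewrite [in RHS](@path_sum_eq _ (fun U => g U * (q' * F x y) -
   \sum_(z in U) q' * F x z * path_sum g (U :\ z) z y)); last first.
  move=> U _; rewrite path_sumE mulrBr; congr (_ - _).
    by rewrite (qrealC (_ * _) (hg U)) mulrA.
  by rewrite mulr_sumr; apply: eq_bigr => z _; rewrite mulrA.
rewrite path_sumB path_sumMr
  (path_sum_extract (fun z U => q' * F x z * path_sum g U z y)).
rewrite mulrBr mulr_sumr q0B q0_sum; congr (_ - _).
by have := q0M (q * path_sum g S a b) (q' * F x y); rewrite !mulrA => ->.
Qed.

Lemma path_sum_insert g S x y a : a \notin S ->
  path_sum g (a |: S) x y =
  path_sum (fun U => g (a |: U)) S x y
  - path_sum (fun U => path_sum g U a y) S x a.
Proof.
elim/set_ind: S x y => S IH x y aS.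
rewrite path_sumE big_setU1 //= setU1K //.
rewrite (path_sumE (fun U => g (a |: U))) (path_sumE (fun U => path_sum g U a y)).
have -> : \sum_(z in S) F x z * path_sum g ((a |: S) :\ z) z y =
    \sum_(z in S) F x z * path_sum (fun U => g (a |: U)) (S :\ z) z y
    - \sum_(z in S) F x z * path_sum (fun U => path_sum g U a y) (S :\ z) z a.
  rewrite -sumrB; apply: eq_bigr => z zS.
  have za : z != a by apply: contraNneq aS => <-.
  have -> : (a |: S) :\ z = a |: S :\ z.
    by apply/setP => w; rewrite !inE; case: (w =P a) => // ->; rewrite eq_sym za.
  by rewrite IH ?cardsD1_lt // ?inE ?negb_and ?aS ?orbT // mulrBr.
rewrite !opprD !opprK !addrA; congr (_ + _); exact: addrAC.
Qed.

(** One pivot per set is asked for, since the cycle ordering in [hdet] directly gives only the least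
    index; [det_pivot] extends this to all indices for Hermitian [F]. *)
Definition is_det (D : {set T} -> H) :=
  D set0 = 1 /\
  forall S, S != set0 -> exists2 i, i \in S & D S = path_sum D (S :\ i) i i.

Hypothesis Fherm : forall x y, qconj (F x y) = F y x.

(** Conjugation reverses each product, and Hermitian symmetry makes it the product along the
    reversed path. *)
Lemma path_sum_conj g S x y : (forall U, U \subset S -> qreal (g U)) ->
  qconj (path_sum g S x y) = path_sum g S y x.
Proof.
elim/set_ind: S x y => S IH x y h.
rewrite path_sumE [RHS]path_sumEr // qconjD qconjN qconjM h // Fherm.
congr (_ - _); rewrite qconj_sum; apply: eq_bigr => z zS.
rewrite qconjM Fherm IH ?cardsD1_lt // => U sU.
by apply: h; apply: subset_trans sU (subsetDl _ _).
Qed.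

Variable D : {set T} -> H.
Hypothesis Ddet : is_det D.

Lemma det_real S : qreal (D S).
Proof.
elim/set_ind: S => S IH; have [->|/Ddet.2[i iS ->]] := eqVneq S set0.
  by rewrite Ddet.1; apply: qreal1.
apply: path_sum_conj => U sU; apply: IH.
exact: leq_ltn_trans (subset_leq_card sU) (cardsD1_lt iS).
Qed.

Lemma path_sum_real S x : qreal (path_sum D S x x).
Proof. by apply: path_sum_conj => U _; apply: det_real. Qed.

(** Either pivot gives two sums over [V]: disjoint loops at [i] and at [j], and one cycle through
    both. Exchanging [i] and [j] only permutes factors cyclically. *)
Lemma det_pivot S i : i \in S -> D S = path_sum D (S :\ i) i i.
Proof.
elim/set_ind: S i => S IH i iS.
have /Ddet.2[j jS DS] : S != set0 by apply/set0Pn; exists i.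
have [<-//|nij] := eqVneq j i.
rewrite DS; pose V := S :\ j :\ i.
have iV : i \notin V by rewrite !inE eqxx.
have jV : j \notin V by rewrite !inE eqxx andbF.
have Si : S :\ i = j |: V.
  by rewrite /V setD1C setD1K // !inE nij.
have Sj : S :\ j = i |: V by rewrite /V setD1K // !inE eq_sym nij.
have IHV k U : k \in S -> k \notin V -> U \subset V -> D (k |: U) = path_sum D U k k.
  move=> kS kV sU; have kU : k \notin U by apply: contra kV; apply/subsetP.
  rewrite (IH _ _ k) ?setU11 ?setU1K //.
  rewrite cardsU1 kU add1n; apply: leq_ltn_trans (cardsD1_lt jS).
  by rewrite Sj cardsU1 iV add1n ltnS subset_leq_card.
rewrite Sj Si !path_sum_insert //.
rewrite (path_sum_eq (g2 := fun U => path_sum D U i i)); last by move=> U; apply: IHV.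
rewrite [in RHS](path_sum_eq (g1 := fun U => D (j |: U))
  (g2 := fun U => path_sum D U j j)); last by move=> U; apply: IHV.
have swap x y a b : q0 (path_sum (fun U => path_sum D U a b) V x y) =
   q0 (path_sum (fun U => path_sum D U x y) V a b).
  have := path_sum_swap V x y a b 1 1 det_real; rewrite !mul1r.
  rewrite (path_sum_eq (g2 := fun U => path_sum D U a b)) => [->|U _]; last exact: mul1r.
  by congr (q0 _); apply: path_sum_eq => U _; apply: mul1r.
(* The exchange holds on real parts, which suffices because both sides are real. *)
apply: qreal_q0_inj; last by rewrite !q0B; congr (_ - _); apply: swap.
  rewrite -(path_sum_eq (g1 := fun U => D (i |: U))); last by move=> U; apply: IHV.
  by rewrite -path_sum_insert //; apply: path_sum_real.
rewrite -(path_sum_eq (g1 := fun U => D (j |: U))); last by move=> U; apply: IHV.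
by rewrite -path_sum_insert //; apply: path_sum_real.
Qed.

(* A repeated row: path from i to y followed by a cycle through i, against the
   same cycle followed by the same path *)
Lemma path_sum_repeat S i y : i \notin S -> path_sum D (i |: S) i y = 0.
Proof.
move=> iS; rewrite path_sum_insert //.
rewrite (path_sum_eq (g2 := fun U => path_sum D U i i)); last first.
  move=> U sU; rewrite (@det_pivot _ i) ?setU11 ?setU1K //.
  by apply: contra iS; apply/subsetP.
apply/eqP; rewrite subr_eq0; apply/eqP/q0_nondegenerate => q.
have := path_sum_swap S i y i i q 1 det_real; rewrite mul1r.
rewrite (path_sum_eq (g2 := fun U => path_sum D U i i * q)) => [|U _].
  rewrite path_sumMr q0M => ->.
  by congr (q0 (q * _)); apply: path_sum_eq => U _; apply: mul1r.
exact/esym/qrealC/path_sum_real.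
Qed.

(** For [j] and [z] in [S], an entry of the adjugate of the principal submatrix on [S]: the
    coefficient of [c z] when [c] replaces row [j] and the row determinant is expanded there. *)
Definition minor_adj S z j :=
  if z == j then D (S :\ j) else - path_sum D (S :\ j :\ z) z j.

Lemma sum_minor_adj S c j : j \in S ->
  \sum_(z in S) c z * minor_adj S z j =
  c j * D (S :\ j) - \sum_(z in S :\ j) c z * path_sum D (S :\ j :\ z) z j.
Proof.
move=> jS; rewrite (big_setD1 j) //= /minor_adj eqxx -sumrN; congr (_ + _).
by apply: eq_bigr => z; rewrite !inE => /andP[/negbTE -> _]; rewrite mulrN.
Qed.

(** The left side is a single path sum from [i] to [j]: a determinant, a repeated row or, for [i]
    outside [S], an adjugate entry of a larger set. The last case links consecutive sizes. *)
Lemma mul_minor_adj S i j : j \in S ->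
  \sum_(z in S) F i z * minor_adj S z j =
  if i == j then D S else if i \in S then 0 else - minor_adj (i |: S) i j.
Proof.
move=> jS; rewrite sum_minor_adj // -path_sumE.
have [->|nij] := eqVneq i j; first by rewrite -det_pivot.
case: ifPn => iS.
  rewrite -(setD1K (a := i) (A := S :\ j)) ?inE ?nij //.
  by rewrite path_sum_repeat // !inE eqxx.
by rewrite /minor_adj (negbTE nij) setD1C setU1K // opprK.
Qed.

End PathSum.

(** * Sums of principal minors *)

Section Transport.
Variables (R : realFieldType) (T' T : finType) (f : T' -> T).
Variables (F : T -> T -> quat R) (F' : T' -> T' -> quat R).
Hypothesis f_inj : injective f.
Hypothesis F'E : forall i j, F' i j = F (f i) (f j).

Lemma imset_setD1 (S : {set T'}) z : f @: (S :\ z) = f @: S :\ f z.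
Proof.
apply/setP => w; rewrite in_setD1; apply/imsetP/andP => [[u]|[nw /imsetP[u uS ew]]].
  by rewrite in_setD1 => /andP[nu uS] ->; rewrite (inj_eq f_inj) imset_f.
by exists u => //; rewrite in_setD1 uS andbT; apply: contraNneq nw => <-; rewrite ew.
Qed.

Lemma path_sum_inj (g : {set T} -> quat R) (g' : {set T'} -> quat R) (S : {set T'}) x y :
  (forall U : {set T'}, U \subset S -> g' U = g (f @: U)) ->
  path_sum F' g' S x y = path_sum F g (f @: S) (f x) (f y).
Proof.
elim/set_ind: S x y => S IH x y h; rewrite path_sumE [RHS]path_sumE h // F'E.
congr (_ - _); rewrite big_imset /=; last by move=> ? ? _ _; apply: f_inj.
apply: eq_bigr => z zS; rewrite F'E IH ?cardsD1_lt ?imset_setD1 // => U sU.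
by apply: h; apply: subset_trans sU (subsetDl _ _).
Qed.

(** The pivots that [is_det] provides for [D] and [D'] need not correspond; [det_pivot] lets [D] be
    expanded at the image of the other. *)
Lemma is_det_inj (D : {set T} -> quat R) (D' : {set T'} -> quat R) (S : {set T'}) :
  (forall i j, qconj (F i j) = F j i) ->
  is_det F D -> is_det F' D' -> D' S = D (f @: S).
Proof.
move=> hF hD hD'; elim/set_ind: S => S IH.
have [->|/hD'.2[i iS ->]] := eqVneq S set0; first by rewrite imset0 hD.1 hD'.1.
rewrite (det_pivot hF hD (i := f i)) ?imset_f // -imset_setD1.
apply: (@path_sum_inj D D') => U sU; apply: IH.
exact: leq_ltn_trans (subset_leq_card sU) (cardsD1_lt iS).
Qed.

End Transport.

Section AdjugateSum.
Variables (R : realFieldType) (n : nat).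
Local Notation H := (quat R).
Variable G : 'M[H]_n.
Hypothesis Gherm : forall i j, qconj (G i j) = G j i.
Variable D : {set 'I_n} -> H.
Hypothesis Ddet : is_det G D.
Implicit Types (S : {set 'I_n}) (i j z : 'I_n).

Definition det_sum k := \sum_(S : {set 'I_n} | #|S| == k) D S.

Definition adj_sum k : 'M[H]_n :=
  \matrix_(z, j) \sum_(S : {set 'I_n} | (#|S| == k) && (j \in S) && (z \in S))
    minor_adj G D S z j.

Lemma sum_set_insert k i (P : pred {set 'I_n}) (E : {set 'I_n} -> H) :
  (forall S, P (i |: S) = P S) ->
  \sum_(S : {set 'I_n} | (#|S| == k.+1) && P S && (i \in S)) E S =
  \sum_(S : {set 'I_n} | (#|S| == k) && P S && (i \notin S)) E (i |: S).
Proof.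
move=> hP; rewrite (reindex_onto (fun S => i |: S) (fun S => S :\ i)) /=; last first.
  by move=> S /andP[_ iS]; rewrite setD1K.
apply: eq_bigl => S; rewrite setU11 andbT hP cardsU1.
have [iS|iS] := boolP (i \in S).
  rewrite andbF; apply/negP => /andP[_ /eqP/setP/(_ i)].
  by rewrite !inE eqxx iS.
by rewrite setU1K // eqxx add1n eqSS !andbT.
Qed.

Lemma row_mul_adj_sum m (c : 'M[H]_(m, n)) k (i : 'I_m) j : (c *m adj_sum k) i j =
  \sum_(S : {set 'I_n} | (#|S| == k) && (j \in S))
    \sum_(z in S) c i z * minor_adj G D S z j.
Proof.
rewrite mxE.
under eq_bigr do rewrite mxE mulr_sumr.
rewrite (exchange_big_dep (fun S : {set 'I_n} => (#|S| == k) && (j \in S))) /=.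
  by apply: eq_bigr => S ->.
by move=> z S _ /andP[].
Qed.

(** With [trace_mul_adj_sum], this is a form of the Faddeev-LeVerrier recursion. *)
Lemma mul_adj_sum k : G *m adj_sum k + adj_sum k.+1 = (det_sum k)%:M.
Proof.
apply/matrixP => i j; rewrite mxE row_mul_adj_sum.
under eq_bigr => S /andP[_ jS] do rewrite (mul_minor_adj Gherm Ddet) //.
rewrite !mxE /det_sum; have [<-|nij] := eqVneq i j; rewrite ?mulr1n ?mulr0n.
  (* On the diagonal, the first term gives the sets containing [i]; the second, after removal of
     [i], gives those that do not. *)
  under [X in _ + X = _]eq_bigl => S do rewrite -andbA andbb -[(_ == _)]andbT.
  rewrite (@sum_set_insert k i predT) // [RHS](bigID (fun S => i \in S)) /=.
  congr (_ + _); apply: eq_big => S; first by rewrite andbT.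
  by move=> /andP[_ iS]; rewrite /minor_adj eqxx setU1K.
(* Off the diagonal, sets containing [i] give a repeated row; the others cancel against
   [adj_sum k.+1]. *)
rewrite (@sum_set_insert k i (fun S => j \in S)); last first.
  by move=> S; rewrite !inE eq_sym (negbTE nij).
rewrite (bigID (fun S => i \in S)) /= big1 ?add0r; last first.
  by move=> S /andP[_ ->].
rewrite -big_split /= big1 // => S /andP[_ /negbTE ->].
by rewrite addNr.
Qed.

Lemma trace_mul_adj_sum k : \sum_j (G *m adj_sum k) j j = det_sum k *+ k.
Proof.
under eq_bigr => j _ do rewrite row_mul_adj_sum.
rewrite (exchange_big_dep (fun S : {set 'I_n} => #|S| == k)) /=; last first.
  by move=> j S _ /andP[].
rewrite -sumrMnl; apply: eq_bigr => S /eqP sS.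
rewrite -sS -sumr_const; apply: eq_big => [j|j /andP[_ jS]]; first by rewrite eqxx.
by rewrite (mul_minor_adj Gherm Ddet) // eqxx.
Qed.

Lemma det_sum_real k : qreal (det_sum k).
Proof. by apply: qreal_sum => S _; apply: (det_real Gherm Ddet). Qed.

Variables (r : nat) (P L : 'M[H]_n).
Hypotheses (LG : L *m G = P) (PG : P *m G = G).
Hypothesis det_sum_gt : forall k, (r < k)%N -> det_sum k = 0.

Lemma adj_sum_gt k : (n < k)%N -> adj_sum k = 0.
Proof.
move=> nk; apply/matrixP => i j; rewrite !mxE big1 // => S /andP[/andP[/eqP sS]].
by have := max_card (mem S); rewrite card_ord sS leqNgt nk.
Qed.

(* Descending induction: from [P *m adj_sum k.+1 = 0] follows
   [G *m adj_sum k = det_sum k *: P], which vanishes when [r < k]. *)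
Lemma range_adj_sum k : (r < k)%N -> P *m adj_sum k = 0.
Proof.
move: (leqnn (n.+1 - k)); move: {2}(n.+1 - k)%N => N.
elim: N k => [|N IH] k lN rk.
  by rewrite adj_sum_gt ?mulmx0 // -subn_eq0 -leqn0.
have PK : P *m adj_sum k.+1 = 0 by apply: IH; lia.
have := congr1 (mulmx L) (congr1 (mulmx P) (mul_adj_sum k)).
rewrite mulmxDr PK addr0 !mulmxA -[L *m P *m G]mulmxA.
by rewrite PG LG det_sum_gt // raddf0 !mulmx0.
Qed.

Lemma mul_adj_sum_rank : G *m adj_sum r = det_sum r *: P.
Proof.
have := congr1 (mulmx P) (mul_adj_sum r).
rewrite mulmxDr range_adj_sum // addr0 mulmxA PG => ->.
apply/matrixP => i j; rewrite !mxE (bigD1 j) //= big1 ?addr0; last first.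
  by move=> z /negbTE nz; rewrite mxE nz mulr0n mulr0.
by rewrite mxE eqxx mulr1n -(qrealC _ (det_sum_real r)).
Qed.

End AdjugateSum.

(** * Path expansion of row determinants *)

(* [t * tperm x z] is obtained from [t], which fixes [x], by inserting [x] just
   before [z] in the cycle of [z]. *)
Section Contraction.
Variables (T : finType) (t : {perm T}) (x z : T).
Hypotheses (tx : t x = x) (zx : z != x).
Let s := (t * tperm x z)%g.

Lemma contract_notin : x \notin porbit t z.
Proof.
rewrite porbit_sym; apply/porbitP => -[i]; rewrite permX.
have -> : iter i t x = x by elim: i => //= i ->.
by move=> /eqP; rewrite (negbTE zx).
Qed.

Lemma contract_x : s x = z.
Proof. by rewrite permM tx tpermL. Qed.

Lemma contract_expg i : (i < #|porbit t z|)%N -> (s ^+ i)%g z = (t ^+ i)%g z.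
Proof.
elim: i => [|i IH] li; first by rewrite !expg0.
rewrite !expgSr !permM IH ?(ltnW li) //; apply: tpermD.
  apply: contraNneq contract_notin => ->.
  by rewrite -permM -expgSr mem_porbit.
rewrite -permM -expgSr permX.
have N0 : (0 < #|porbit t z|)%N by apply: leq_ltn_trans li.
(* The iterates of [z] within one period are distinct, so the orbit has not yet returned to [z]. *)
have := @nth_uniq _ z (traject t z #|porbit t z|) 0 i.+1.
by rewrite size_traject !nth_traject // => ->; rewrite ?uniq_traject_porbit.
Qed.

Lemma contract_expg_out h i : h \notin porbit t z -> h != x ->
  (s ^+ i)%g h = (t ^+ i)%g h.
Proof.
move=> hz hx; elim: i => [|i IH]; first by rewrite !expg0.
rewrite !expgSr !permM IH; apply: tpermD; rewrite -permM -expgSr.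
  rewrite eq_sym; apply: contraNneq hx => e.
  have /eqP : (t ^+ i.+1)%g h = (t ^+ i.+1)%g x.
    by rewrite e permX; elim: i.+1 => //= m <-.
  by rewrite (inj_eq perm_inj).
by apply: contraNneq hz => ->; rewrite porbit_sym mem_porbit.
Qed.

Lemma porbit_contract : porbit s x = x |: porbit t z.
Proof.
apply/setP => w; apply/idP/setU1P => [/porbitP[i ->]|[->|]]; last 1 first.
- rewrite porbit_traject => /trajectP[i li ->].
  by rewrite -permX -contract_expg // -contract_x -permM -expgS mem_porbit.
- elim: i => [|i IH]; first by left; rewrite expg0 perm1.
  rewrite expgSr permM; case: IH => [->|iz].
    by right; rewrite contract_x porbit_id.
  have iz' : t ((s ^+ i)%g x) \in porbit t z.
    by move/porbitP: iz => [m ->]; rewrite -permM -expgSr mem_porbit.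
  rewrite permM; case: tpermP => [||_ _]; [by right; rewrite porbit_id|by left|by right].
- exact: porbit_id.
Qed.

Lemma porbit_contract_out h : h \notin porbit t z -> h != x -> porbit s h = porbit t h.
Proof.
move=> hz hx; apply/setP => w.
by apply/porbitP/porbitP => -[i ->]; exists i; rewrite contract_expg_out.
Qed.

Lemma odd_contract : odd_perm s = ~~ odd_perm t.
Proof. by rewrite odd_permM odd_tperm eq_sym zx addbT. Qed.

End Contraction.

Lemma perm_onU1 (T : finType) (S : {set T}) x (t : {perm T}) : x \notin S ->
  perm_on S t = perm_on (x |: S) t && (t x == x).
Proof.
move=> xS; apply/idP/andP => [tS|[txS /eqP tx]].
  by split; [apply: subset_trans tS (subsetUr _ _) | rewrite (out_perm tS)].
apply/subsetP => w wt; have /setU1P[wx|//] := subsetP txS w wt.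
by move: wt; rewrite wx inE tx eqxx.
Qed.

Section PermExpansion.
Variables (R : realFieldType) (k : nat).
Local Notation H := (quat R).
Variable F : 'M[H]_k.
Implicit Types (S : {set 'I_k}) (s t : {perm 'I_k}) (x y z h : 'I_k).

(** The last edge of the cycle through [x] is redirected to [y]: a free endpoint is needed because
    removing the first edge leaves an open path. *)
Definition cyc_path s x y : H :=
  (\prod_(i < #|porbit s x|.-1) F ((s ^+ i)%g x) ((s ^+ i.+1)%g x)) *
  F ((s ^+ #|porbit s x|.-1)%g x) y.

(** Permutations of the full index set are used, so that nothing is reindexed when [S] shrinks. *)
Definition perm_det S : H := \sum_(s : {perm 'I_k} | perm_on S s) (-1) ^+ s *
  \prod_(h <- enum 'I_k | (h \in S) && cyc_min s h) cyc_prod F s h.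

Definition perm_path S x y : H :=
  \sum_(s : {perm 'I_k} | perm_on (x |: S) s) (-1) ^+ s *
    (cyc_path s x y *
     \prod_(h <- enum 'I_k | (h \in S) && ((h \notin porbit s x) && cyc_min s h))
       cyc_prod F s h).

Lemma cyc_signE s : cyc_sign R s = (-1) ^+ (s : bool).
Proof.
have le : (#|porbits s| <= k)%N by rewrite -[k in (_ <= k)%N]card_ord leq_imset_card.
by rewrite /cyc_sign -signr_odd oddB // /odd_perm card_ord.
Qed.

Lemma porbit_gt0 s x : (0 < #|porbit s x|)%N.
Proof. by apply/card_gt0P; exists x; apply: porbit_id. Qed.

Lemma cyc_path_loop s x : cyc_path s x x = cyc_prod F s x.
Proof.
rewrite /cyc_path /cyc_prod.
move: (porbit_gt0 s x) (iter_porbit s x); case: #|porbit s x| => // N _ e /=.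
by rewrite big_ord_recr /= [(s ^+ N.+1)%g x]permX e.
Qed.

Lemma porbit_fixed s x : s x = x -> porbit s x = [set x].
Proof.
move=> sx; apply/setP => w; rewrite inE; apply/porbitP/eqP => [[i ->]|->]; last first.
  by exists 0; rewrite expg0 perm1.
by rewrite permX; elim: i => //= i ->.
Qed.

Lemma cyc_path_fixed s x y : s x = x -> cyc_path s x y = F x y.
Proof.
move=> /porbit_fixed e.
by rewrite /cyc_path e cards1 /= big_ord0 mul1r expg0 perm1.
Qed.

Lemma cyc_path_contract t x y z : t x = x -> z != x ->
  cyc_path (t * tperm x z)%g x y = F x z * cyc_path t z y.
Proof.
move=> tx zx; set s := (t * _)%g; have sx : s x = z by apply: contract_x.
rewrite /cyc_path porbit_contract // cardsU1 contract_notin // add1n /=.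
have := contract_expg tx zx; rewrite -/s.
move: (porbit_gt0 t z); case: #|porbit t z| => // N _ /= st.
have st1 i : (i < N.+1)%N -> (s ^+ i.+1)%g x = (t ^+ i)%g z.
  by move=> iN; rewrite expgS permM sx st.
rewrite big_ord_recl -mulrA expg0 perm1 st1 // expg0 perm1; congr (_ * _).
rewrite st1 //; congr (_ * _); apply: eq_bigr => i _.
by rewrite /bump !st1 // ltnS ltnW.
Qed.

Lemma cyc_prod_contract t x z h : t x = x -> z != x -> h \notin porbit t z ->
  h != x -> cyc_prod F (t * tperm x z)%g h = cyc_prod F t h.
Proof.
move=> tx zx hz hx; rewrite /cyc_prod porbit_contract_out //.
by apply: eq_bigr => i _; rewrite !contract_expg_out.
Qed.

(** Such permutations are [t * tperm x z] with [t] fixing [x]; cutting [x] out of its cycle releases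
    the factor [F x z] and flips the sign. *)
Lemma perm_path_contract S x y z : x \notin S -> z \in S ->
  \sum_(s : {perm 'I_k} | perm_on (x |: S) s && (s x == z)) (-1) ^+ s *
    (cyc_path s x y *
     \prod_(h <- enum 'I_k | (h \in S) && ((h \notin porbit s x) && cyc_min s h))
       cyc_prod F s h) = - (F x z * perm_path (S :\ z) z y).
Proof.
move=> xS zS; have zx : z != x by apply: contraNneq xS => <-.
rewrite (reindex_inj (mulIg (tperm x z))) /= /perm_path setD1K // mulr_sumr -sumrN.
apply: eq_big => [t|t /andP[_ txz]].
  rewrite (@perm_onU1 _ S x) // permM.
  have -> : (tperm x z (t x) == z) = (t x == x).
    by rewrite -[X in _ == X](tpermL x z) (inj_eq perm_inj).
  congr (_ && _); have tp : perm_on (x |: S) (tperm x z).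
    by apply: subset_trans (tperm_on x z) _; apply/subsetP => w;
       rewrite !inE => /orP[->//|/eqP->]; rewrite zS orbT.
  apply/idP/idP => [h|h]; last exact: perm_onM.
  by have := perm_onM h tp; rewrite -mulgA tperm2 mulg1.
have tx : t x = x by apply: (@perm_inj _ (tperm x z)); rewrite -permM tpermL; apply/eqP.
rewrite odd_contract // cyc_path_contract // signrN mulNr; congr (- _).
transitivity ((-1) ^+ t * (F x z * cyc_path t z y * \prod_(h <- enum 'I_k |
    (h \in S :\ z) && ((h \notin porbit t z) && cyc_min t h)) cyc_prod F t h)).
  congr (_ * (_ * _)); apply: eq_big => h; last first.
    move=> /and3P[hS]; rewrite porbit_contract // !inE negb_or => /andP[hx hz] _.
    exact: cyc_prod_contract.
  rewrite porbit_contract // !inE negb_or.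
  have [hz|hz] := boolP (h \in porbit t z); first by rewrite !andbF.
  have -> : h != z by apply: contraNneq hz => ->; apply: porbit_id.
  have [->|hx] := eqVneq h x; first by rewrite (negbTE xS).
  by rewrite /cyc_min porbit_contract_out.
by rewrite !mulr_sign -mulrA; case: (odd_perm t); rewrite ?mulrN.
Qed.

Lemma perm_pathE S x y : x \notin S ->
  perm_path S x y = F x y * perm_det S - \sum_(z in S) F x z * perm_path (S :\ z) z y.
Proof.
move=> xS; rewrite {1}/perm_path (partition_big (fun s => s x) (mem (x |: S))) /=.
  rewrite big_setU1 //= -sumrN; congr (_ + _); last first.
    by apply: eq_bigr => z zS; apply: perm_path_contract.
  rewrite /perm_det mulr_sumr; apply: eq_big => [s|s /andP[_ /eqP sx]].
    by rewrite -perm_onU1.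
  rewrite cyc_path_fixed // (eq_bigl (fun h => (h \in S) && cyc_min s h)).
    by rewrite !mulr_sign; case: odd_perm; rewrite ?mulrN.
  move=> h; rewrite porbit_fixed // inE.
  by have [->|] := eqVneq h x; rewrite ?(negbTE xS).
by move=> s sS; rewrite perm_closed // setU11.
Qed.

Lemma perm_path_sum S x y : x \notin S -> perm_path S x y = path_sum F perm_det S x y.
Proof.
elim/set_ind: S x y => S IH x y xS; rewrite perm_pathE // path_sumE.
congr (_ - _); apply: eq_bigr => z zS.
by rewrite IH ?cardsD1_lt // !inE eqxx.
Qed.

(** Without commutativity a factor can be split off on the left only if it comes first, which the
    sorted enumeration ensures for the least index. *)
Lemma big_enum_min (P : pred 'I_k) (m : 'I_k) (E : 'I_k -> H) :
  P m -> (forall h, P h -> (m <= h)%N) ->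
  \prod_(h <- enum 'I_k | P h) E h = E m * \prod_(h <- enum 'I_k | P h && (h != m)) E h.
Proof.
move=> Pm Pmin.
pose lt (x y : 'I_k) := (x < y)%N.
have lt_tr : transitive lt by move=> b a c; apply: ltn_trans.
have lt_enum : sorted lt (enum 'I_k).
  by have := iota_ltn_sorted 0 k; rewrite -val_enum_ord sorted_map.
have e : [seq h <- enum 'I_k | P h] = m :: [seq h <- enum 'I_k | P h && (h != m)].
  apply: (@irr_sorted_eq _ lt) => //; first by move=> a; rewrite /lt ltnn.
  - exact: sorted_filter.
  - rewrite /= path_sortedE //; apply/andP; split.
      apply/allP => h; rewrite mem_filter => /andP[/andP[/Pmin le nh] _].
      by rewrite /lt ltn_neqAle le andbT eq_sym.
    exact: sorted_filter.
  move=> h; rewrite in_cons mem_filter [X in _ = _ || X]mem_filter mem_enum !andbT.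
  by have [->|] := eqVneq h m; rewrite ?Pm // andbT.
by rewrite -big_filter e big_cons big_filter.
Qed.

Lemma is_det_perm_det : is_det F perm_det.
Proof.
split=> [|S /set0Pn[j jS]].
  rewrite /perm_det (big_pred1 1%g) => [|s].
    by rewrite odd_perm1 mul1r big_pred0 // => h; rewrite inE.
  apply/idP/eqP => [s0|->]; last exact: perm_on1.
  by apply/perm.permP => h; rewrite perm1 (out_perm s0) ?inE.
(* The cycle through the least index is the first factor of the ordered product, so [m] serves as
   pivot. *)
pose m := [arg min_(i < j in S) (i : nat)].
have [mS mmin] : m \in S /\ forall h, h \in S -> (m <= h)%N.
  by rewrite /m; case: arg_minnP.
exists m => //; rewrite -perm_path_sum ?setD11 // /perm_det /perm_path setD1K //.
apply: eq_bigr => s sS; congr (_ * _).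
rewrite (@big_enum_min _ m) ?cyc_path_loop.
- congr (_ * _); apply: eq_bigl => h; rewrite !inE.
  have [->|hm] := eqVneq h m; rewrite ?andbF //= andbT andbCA andbC andbA.
  have [hs|//] := boolP (h \in S); rewrite ?andbF //= andbT.
  apply/idP/idP => [cs|/andP[/andP[]]//]; rewrite cs !andbT; apply: contra hm => hms.
  rewrite -val_eqE eqn_leq mmin // andbT.
  by move/forall_inP: cs; apply; rewrite porbit_sym.
- rewrite mS; apply/forall_inP => h hm; apply: mmin.
  by move/porbitP: hm => [i ->]; elim: i => [|i IH];
    rewrite ?expg0 ?perm1 // expgSr permM perm_closed.
- by move=> h /andP[/mmin].
Qed.

Lemma hdetE : hdet F = perm_det setT.
Proof.
apply: eq_big => [s|s _]; first by apply/esym/subsetP => h; rewrite inE.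
by rewrite cyc_signE; congr (_ * _); apply: eq_bigl => h; rewrite inE.
Qed.

Lemma rdetE i : rdet F i = path_sum F perm_det (setT :\ i) i i.
Proof.
rewrite -perm_path_sum ?setD11 // /perm_path setD1K ?inE //.
apply: eq_big => [s|s _]; first by apply/esym/subsetP => h; rewrite inE.
rewrite cyc_signE cyc_path_loop; congr (_ * (_ * _)); apply: eq_bigl => h.
rewrite !inE andbT; have [->|] := eqVneq h i; rewrite ?porbit_id //.
Qed.

End PermExpansion.

(** * Column determinants and index sets *)

Section RowExtensionality.
Variables (R : realFieldType).
Local Notation H := (quat R).

(** The endpoint [y] is used only as a column, so replacing its row does not affect edges of paths
    that merely end there. *)
Lemma path_sum_eq_rows (T : finType) (F1 F2 : T -> T -> H) g1 g2 (S : {set T}) x y :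
  (forall u v, u \in x |: S -> F1 u v = F2 u v) ->
  (forall U : {set T}, U \subset S -> g1 U = g2 U) ->
  path_sum F1 g1 S x y = path_sum F2 g2 S x y.
Proof.
elim/set_ind: S x => S IH x hF hg; rewrite !path_sumE hF ?setU11 // hg //.
congr (_ - _); apply: eq_bigr => z zS; rewrite hF ?setU11 // IH ?cardsD1_lt //.
  by move=> u v; rewrite setD1K // => uS; apply: hF; rewrite inE uS orbT.
by move=> U sU; apply: hg; apply: subset_trans sU (subsetDl _ _).
Qed.

Lemma perm_det_eq_rows k (F1 F2 : 'M[H]_k) (S : {set 'I_k}) :
  (forall u v, u \in S -> F1 u v = F2 u v) -> perm_det F1 S = perm_det F2 S.
Proof.
move=> hF; apply: eq_bigr => s sS; congr (_ * _); apply: eq_bigr => h /andP[hS _].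
apply: eq_bigr => i _; apply: hF.
by elim: (i : nat) => [|m IH]; rewrite ?expg0 ?perm1 // expgSr permM perm_closed.
Qed.

End RowExtensionality.

Section ConjugateTranspose.
Variable R : realFieldType.
Local Notation H := (quat R).

Lemma qconj_prod I (r : seq I) (P : pred I) (E : I -> H) :
  qconj (\prod_(i <- r | P i) E i) = \prod_(i <- rev r | P i) qconj (E i).
Proof.
elim: r => [|i r IH]; first by rewrite !big_nil qconj1.
rewrite big_cons rev_cons -cats1 big_cat /= big_cons big_nil.
by case: (P i); rewrite ?qconjM IH mulr1.
Qed.

Lemma qconj_prod_ord N (E : nat -> H) :
  qconj (\prod_(i < N) E i) = \prod_(i < N) qconj (E (N - i.+1)%N).
Proof.
elim: N => [|N IH]; first by rewrite !big_ord0 qconj1.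
by rewrite big_ord_recr big_ord_recl qconjM IH subn1.
Qed.

Lemma qconj_cyc_prod k (F : 'M[H]_k) (s : {perm 'I_k}) h :
  qconj (cyc_prod (cadj F) s h) = cyc_prod F (s^-1)%g h.
Proof.
have eV : porbit (s^-1)%g h = porbit s h by rewrite porbitV.
rewrite /cyc_prod eV; set N := #|porbit s h|.
rewrite (qconj_prod_ord N (fun i => cadj F ((s ^+ i)%g h) ((s ^+ i.+1)%g h))).
have pV i : (i <= N)%N -> ((s^-1) ^+ i)%g h = (s ^+ (N - i))%g h.
  move=> iN; apply: (@perm_inj _ (s ^+ i)%g); rewrite -!permM expVgn mulVg perm1.
  by rewrite -expgD subnK // permX /N iter_porbit.
apply: eq_bigr => i _; rewrite mxE qconjK !pV //; last exact: ltnW.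
by rewrite -subSn // subSS.
Qed.

(** Conjugation reverses the order of the cycles and the direction of each; passing to inverse
    permutations restores the direction. Column results thus follow from row results. *)
Lemma cdetE k (F : 'M[H]_k) j : cdet F j = qconj (rdet (cadj F) j).
Proof.
rewrite /cdet /rdet qconj_sum (reindex_inj invg_inj) /=.
apply: eq_bigr => s _; rewrite !qconjM qconj_cyc_prod qconj_prod !cyc_signE odd_permV.
rewrite mulr_sign; have -> : qconj ((-1) ^+ s : H) = (-1) ^+ s.
  by case: odd_perm; rewrite ?expr0 ?expr1 ?qconjN qconj1.
have -> : \prod_(h <- rev (enum 'I_k) | (h \notin porbit (s^-1)%g j) && cyc_min (s^-1)%g h)
     cyc_prod F (s^-1)%g h =
  \prod_(h <- rev (enum 'I_k) | (h \notin porbit s j) && cyc_min s h)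
     qconj (cyc_prod (cadj F) s h).
  apply: eq_big => h; last by rewrite qconj_cyc_prod.
  by rewrite /cyc_min !porbitV.
by case: odd_perm; rewrite ?expr0 ?expr1 ?mulrN1 ?mulr1.
Qed.

Lemma sum_cdetE n k (F : 'M[H]_n) i : sum_cdet k F i = qconj (sum_rdet k (cadj F) i).
Proof.
rewrite /sum_cdet qconj_sum; apply: eq_bigr => b _; rewrite qconj_sum.
apply: eq_bigr => a _; rewrite cdetE.
have -> // : cadj (psub F b) = psub (cadj F) b.
by apply/matrixP => x y; rewrite !mxE.
Qed.

Lemma cadj_col_repl p q (F : 'M[H]_(p, q)) j b :
  cadj (col_repl F j b) = row_repl (cadj F) j (cadj b).
Proof. by apply/matrixP => x y; rewrite !mxE; case: eqP. Qed.

End ConjugateTranspose.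

Section PrincipalSums.
Variables (R : realFieldType) (n : nat).
Local Notation H := (quat R).
Variable G : 'M[H]_n.
Hypothesis Gherm : forall i j, qconj (G i j) = G j i.
Let D := perm_det G.
Let Ddet : is_det G D := is_det_perm_det G.

Lemma incr_uniq k (b : k.-tuple 'I_n) : incr b -> uniq b.
Proof.
apply: sorted_uniq; first by move=> y x z; apply: ltn_trans.
by move=> x; apply: ltnn.
Qed.

Lemma sum_incr k (P : pred {set 'I_n}) (E : {set 'I_n} -> H) :
  \sum_(b : k.-tuple 'I_n | incr b && P [set x in b]) E [set x in b] =
  \sum_(S : {set 'I_n} | (#|S| == k) && P S) E S.
Proof.
pose set_of (b : k.-tuple 'I_n) := [set x in b].
pose A := [set b : k.-tuple 'I_n | incr b && P (set_of b)].
transitivity (\sum_(S in set_of @: A) E S).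
  rewrite big_imset => [|b b'].
    by apply: eq_bigl => b; rewrite inE.
  rewrite !inE => /andP[ib _] /andP[ib' _] /setP e; apply: val_inj.
  apply: (irr_sorted_eq _ _ ib ib').
  - by move=> y x z; apply: ltn_trans.
  - by move=> x; apply: ltnn.
  by move=> x; have := e x; rewrite !inE.
apply: eq_bigl => S; apply/imsetP/andP => [[b]|[/eqP cS PS]].
  rewrite inE => /andP[ib Pb] ->; split => //.
  by rewrite cardsE (card_uniqP _) ?size_tuple // incr_uniq.
have sS : size (enum S) == k by rewrite -cardE cS.
have eS : set_of (Tuple sS) = S by apply/setP => x; rewrite inE /= mem_enum.
exists (Tuple sS); rewrite // inE eS PS andbT /incr.
rewrite /= {1}/enum_mem -enumT; apply: sorted_filter.
  by move=> y x z; apply: ltn_trans.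
by have := iota_ltn_sorted 0 n; rewrite -val_enum_ord sorted_map.
Qed.

Variables (k : nat) (b : k.-tuple 'I_n).
Hypothesis b_incr : incr b.

Lemma incr_tnth_inj : injective (tnth b).
Proof. by apply/injectiveP; rewrite /injectiveb /dinjectiveb map_tnth_enum incr_uniq. Qed.

Lemma imset_tnth : tnth b @: [set: 'I_k] = [set x in b].
Proof.
apply/setP => x; rewrite inE; apply/imsetP/tnthP => -[a]; first by exists a.
by exists a; rewrite ?inE.
Qed.

Lemma perm_det_psub (U : {set 'I_k}) : perm_det (psub G b) U = D (tnth b @: U).
Proof.
have psubE x y : psub G b x y = G (tnth b x) (tnth b y) by rewrite mxE.
exact: (@is_det_inj _ _ _ _ _ _ incr_tnth_inj psubE _ _ U Gherm Ddet (is_det_perm_det _)).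
Qed.

(** Only the first edge leaves from the replaced row; all that follows involves rows of [G]
    alone. *)
Lemma rdet_psub_row_repl (c : 'rV[H]_n) a :
  let j := tnth b a in let S := [set x in b] in
  rdet (psub (row_repl G j c) b) a = \sum_(z in S) c 0 z * minor_adj G D S z j.
Proof.
move=> j S; have jS : j \in S by rewrite inE mem_tnth.
rewrite rdetE path_sumE sum_minor_adj //.
have F'E x y : psub (row_repl G j c) b x y =
    if x == a then c 0 (tnth b y) else psub G b x y.
  by rewrite !mxE (inj_eq incr_tnth_inj).
have SE : S :\ j = tnth b @: (setT :\ a).
  by rewrite (imset_setD1 incr_tnth_inj) imset_tnth.
have rowsE x y : x != a -> psub (row_repl G j c) b x y = psub G b x y.
  by move=> /negbTE xa; rewrite F'E xa.
have detE (U : {set 'I_k}) : U \subset setT :\ a ->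
    perm_det (psub (row_repl G j c) b) U = D (tnth b @: U).
  move=> sU; rewrite -perm_det_psub; apply: perm_det_eq_rows => x y xU.
  by apply: rowsE; have := subsetP sU x xU; rewrite !inE andbT.
rewrite F'E eqxx detE // SE; congr (_ - _).
rewrite big_imset /=; last by move=> x y _ _; apply: incr_tnth_inj.
apply: eq_bigr => z za; rewrite F'E eqxx; congr (_ * _).
rewrite -(imset_setD1 incr_tnth_inj).
transitivity (path_sum (psub G b) (perm_det (psub G b)) (setT :\ a :\ z) z a).
  apply: path_sum_eq_rows => [x y|U sU].
    by rewrite setD1K // => xa; apply: rowsE; move: xa; rewrite !inE andbT.
  by rewrite perm_det_psub detE // (subset_trans sU) ?subsetDl.
apply: (path_sum_inj incr_tnth_inj) => [x y|U _]; first by rewrite mxE.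
exact: perm_det_psub.
Qed.

End PrincipalSums.

Section SumFormulas.
Variables (R : realFieldType) (n : nat).
Local Notation H := (quat R).
Variable G : 'M[H]_n.
Hypothesis Gherm : forall i j, qconj (G i j) = G j i.

Lemma sum_hdetE k : sum_hdet k G = det_sum (perm_det G) k.
Proof.
rewrite /sum_hdet /det_sum; transitivity (\sum_(b : k.-tuple 'I_n | incr b && true)
    perm_det G [set x in b]).
  apply: eq_big => [b|b ib]; first by rewrite andbT.
  by rewrite hdetE perm_det_psub // imset_tnth.
rewrite (sum_incr k predT (perm_det G)).
by apply: eq_bigl => S; rewrite andbT.
Qed.

Lemma sum_rdet_row_repl k j (c : 'rV[H]_n) :
  sum_rdet k (row_repl G j c) j = (c *m adj_sum G (perm_det G) k) 0 j.
Proof.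
rewrite row_mul_adj_sum -(sum_incr k (fun S => j \in S)
  (fun S => \sum_(z in S) c 0 z * minor_adj G (perm_det G) S z j)).
apply: eq_big => [b|b /andP[ib]]; first by rewrite inE.
case/tnthP => a ->; rewrite (big_pred1 a) => [|a'].
  exact: rdet_psub_row_repl.
by rewrite (inj_eq (incr_tnth_inj ib)).
Qed.

End SumFormulas.

(** * Gram matrices *)

Section Adjoint.
Variable R : realFieldType.
Local Notation H := (quat R).

Lemma cadjK m n (A : 'M[H]_(m, n)) : cadj (cadj A) = A.
Proof. by apply/matrixP => i j; rewrite !mxE qconjK. Qed.

Lemma cadjM m n p (A : 'M[H]_(m, n)) (B : 'M[H]_(n, p)) :
  cadj (A *m B) = cadj B *m cadj A.
Proof.
apply/matrixP => i j; rewrite !mxE qconj_sum; apply: eq_bigr => k _.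
by rewrite qconjM !mxE.
Qed.

Lemma cadj0 m n : cadj (0 : 'M[H]_(m, n)) = 0.
Proof. by apply/matrixP => i j; rewrite !mxE qconj0. Qed.

Lemma mulmxZr_real m n p (A : 'M[H]_(m, n)) (B : 'M[H]_(n, p)) d :
  qreal d -> A *m (d *: B) = d *: (A *m B).
Proof.
move=> dr; apply/matrixP => i j; rewrite !mxE mulr_sumr; apply: eq_bigr => k _.
by rewrite mxE !mulrA (qrealC _ dr).
Qed.

Lemma q0_real_mul (d x : H) : qreal d -> q0 (d * x) = q0 d * q0 x.
Proof. by move/qrealE ->; case: x => a b c e; rewrite /GRing.mul /= !mul0r !subr0. Qed.

Lemma qreal_eq0 (d : H) : qreal d -> (d == 0) = (q0 d == 0).
Proof.
move=> dr; apply/eqP/eqP => [->//|e]; apply: qreal_q0_inj => //.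
exact: qreal0.
Qed.

Lemma is_MP_inverse_cadj m n (A : 'M[H]_(m, n)) (X : 'M[H]_(n, m)) :
  is_MP_inverse A X -> is_MP_inverse (cadj A) (cadj X).
Proof.
move=> [AXA XAX AX XA]; split; rewrite -?cadjM ?cadjK ?mulmxA ?AXA ?XAX ?XA ?AX //.
Qed.

End Adjoint.

Section Gram.
Variables (R : realFieldType) (m n : nat) (A : 'M[quat R]_(m, n)).
Local Notation H := (quat R).
Let G := cadj A *m A.
Let D := perm_det G.

Lemma gram_herm i j : qconj (G i j) = G j i.
Proof.
have e : cadj G = G by rewrite cadjM cadjK.
by rewrite -[in RHS]e [RHS]mxE.
Qed.

Let Ddet : is_det G D := is_det_perm_det G.
Let Dreal S : qreal (D S) := det_real gram_herm Ddet S.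

Definition minor_col (S : {set 'I_n}) j : 'cV[H]_n :=
  \col_z if z \in S then minor_adj G D S z j else 0.

(** On [S], the vector [G *m minor_col S j] is [D S] at [j] and [0] elsewhere, by [mul_minor_adj];
    outside [S], [u] vanishes. *)
Lemma gram_minor_col (S : {set 'I_n}) j (u : 'cV[H]_n) : j \in S ->
  (forall i, i \notin S -> u i 0 = 0) ->
  (cadj u *m G *m minor_col S j) 0 0 = qconj (u j 0) * D S.
Proof.
move=> jS uS; rewrite -mulmxA mxE.
have Gk i : (G *m minor_col S j) i 0 = \sum_(z in S) G i z * minor_adj G D S z j.
  rewrite mxE [RHS]big_mkcond /=; apply: eq_bigr => z _; rewrite [minor_col S j z 0]mxE.
  by case: ifP; rewrite ?mulr0.
rewrite (bigD1 j) //= big1 ?addr0 => [|i ij].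
  by rewrite Gk (mul_minor_adj gram_herm Ddet) // eqxx mxE.
rewrite Gk (mul_minor_adj gram_herm Ddet) // (negbTE ij) mxE.
by case: ifP => [_|/negbT/uS ->]; rewrite ?mulr0 // qconj0 mul0r.
Qed.

(** If [c] is supported on [S] and [A *m c = 0], then [gram_minor_col] gives
    [qconj (c j 0) * D S = 0] for each [j] in [S]. *)
Lemma gram_det_indep S : D S != 0 -> col_indep A S.
Proof.
move=> DS c cS Ac; apply/colP => j; rewrite mxE.
have [jS|/cS//] := boolP (j \in S).
have := gram_minor_col jS cS.
rewrite /G mulmxA -cadjM Ac cadj0 !mul0mx mxE => /esym e.
have DU : D S \is a GRing.unit by [].
apply: (can_inj (@qconjK R)); rewrite qconj0 -[LHS](mulrK DU) e; exact: mul0r.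
Qed.

Lemma qnorm_sum_gt0 k (v : 'cV[H]_k) : v != 0 -> 0 < q0 ((cadj v *m v) 0 0).
Proof.
move=> v0; rewrite mxE q0_sum.
have e i : q0 (cadj v 0 i * v i 0) = qnorm2 (v i 0) by rewrite mxE qconjMl.
rewrite (eq_bigr _ (fun i _ => e i)) lt0r sumr_ge0 ?andbT => [|i _];
  last exact: qnorm2_ge0.
apply: contraNneq v0 => /eqP; rewrite psumr_eq0 => [|i _]; last exact: qnorm2_ge0.
move/allP => h; apply/eqP/colP => i; apply/eqP; rewrite mxE -qnorm2_eq0.
by apply: h; rewrite mem_index_enum.
Qed.

(** Induction with the test vector [u = minor_col S j]: its entry at [j] is [D (S :\ j)], positive,
    so [A *m u] is nonzero, and its squared norm is [D (S :\ j) * D S]. *)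
Lemma gram_det_gt0 S : col_indep A S -> 0 < q0 (D S).
Proof.
elim/set_ind: S => S IH indS.
have [->|[j jS]] := set_0Vmem S; first by rewrite Ddet.1 /= ltr01.
have Dj : 0 < q0 (D (S :\ j)).
  apply: IH; first exact: cardsD1_lt.
  by move=> c cS; apply: indS => i iS; apply: cS; rewrite inE (negbTE iS) andbF.
pose u := minor_col S j.
have uS i : i \notin S -> u i 0 = 0 by move=> /negbTE iS; rewrite mxE iS.
have uj : u j 0 = D (S :\ j) by rewrite mxE jS /minor_adj eqxx.
have Au : A *m u != 0.
  apply/eqP => /(indS u uS) u0; move: Dj.
  by rewrite -uj u0 mxE ltxx.
have := qnorm_sum_gt0 Au; rewrite cadjM mulmxA -(mulmxA (cadj u)).
by rewrite gram_minor_col // uj Dreal q0_real_mul // pmulr_rgt0.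
Qed.

Lemma gram_det_ge0 S : 0 <= q0 (D S).
Proof.
have [->//|/gram_det_indep/gram_det_gt0/ltW //] := eqVneq (D S) 0.
Qed.

(** A rank read off from minors; [det_rank_exists] supplies it for [cadj A], where [has_rank] is not
    assumed. *)
Definition det_rank r :=
  (forall k, (r < k)%N -> det_sum D k = 0) /\ det_sum D r != 0.

(** Minors on larger sets vanish by dependence. At size [r] all are nonnegative and one is positive,
    so nothing cancels. *)
Lemma has_rank_det_rank r : has_rank A r -> det_rank r.
Proof.
move=> [[S0 [cS0 indS0]] maxr]; split=> [k rk|].
  rewrite /det_sum big1 // => S /eqP cS; apply/eqP; apply: contraLR rk.
  by move=> /gram_det_indep/maxr; rewrite cS -leqNgt.
rewrite (qreal_eq0 (det_sum_real gram_herm Ddet r)) /det_sum q0_sum.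
rewrite (bigD1 S0) ?cS0 //= gt_eqF // ltr_pwDl ?gram_det_gt0 // sumr_ge0 // => S _.
exact: gram_det_ge0.
Qed.

Lemma det_rank_exists : exists r, det_rank r.
Proof.
have h0 : exists k, det_sum D k != 0.
  exists 0%N; rewrite /det_sum (big_pred1 set0) => [|S]; last by rewrite cards_eq0.
  by rewrite Ddet.1 oner_eq0.
have hn k : det_sum D k != 0 -> (k <= n)%N.
  apply: contraR; rewrite -ltnNge => nk; apply/eqP; rewrite /det_sum big1 // => S /eqP cS.
  by have := max_card (mem S); rewrite card_ord cS leqNgt nk.
case: (ex_maxnP h0 hn) => r hr maxr; exists r; split=> // k rk.
by apply/eqP; apply: contraLR rk => /maxr; rewrite -leqNgt.
Qed.

Variable X : 'M[H]_(n, m).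
Hypothesis AX : is_MP_inverse A X.
Let P := X *m A.

(** This makes [X *m cadj X] the left factor [L] of [mul_adj_sum_rank]. *)
Lemma MP_gram : X *m cadj X *m G = P.
Proof.
case: AX => AXA XAX AXh _.
by rewrite /G mulmxA -(mulmxA X) -cadjM AXh mulmxA XAX.
Qed.

Lemma MP_proj_gram : P *m G = G.
Proof.
case: AX => AXA XAX _ XAh.
by rewrite /P -XAh /G mulmxA -cadjM mulmxA AXA.
Qed.

Lemma gram_MP : G *m X = cadj A.
Proof.
case: AX => AXA XAX AXh _.
by rewrite /G -mulmxA -AXh -cadjM AXA.
Qed.

Variable r : nat.
Hypothesis rankG : det_rank r.
Let d := det_sum D r.

Lemma gram_adj_sum : G *m adj_sum G D r = d *: P.
Proof. exact: (mul_adj_sum_rank gram_herm Ddet MP_gram MP_proj_gram rankG.1). Qed.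

(** The trace of [G *m adj_sum G D r] is computed twice, by [trace_mul_adj_sum] and by
    [gram_adj_sum]; the nonzero real [d] then cancels. *)
Lemma det_rank_trace : r%:R = \sum_j q0 (P j j).
Proof.
have dr : qreal d := det_sum_real gram_herm Ddet r.
have d0 : q0 d != 0 by rewrite -(qreal_eq0 dr) rankG.2.
have := trace_mul_adj_sum gram_herm Ddet r; rewrite gram_adj_sum -/d.
move/(congr1 (@q0 R)); rewrite q0_sum -[d *+ r]mulr_natr q0_real_mul //.
under eq_bigr do rewrite mxE q0_real_mul //.
rewrite -mulr_sumr => /(mulfI d0) ->.
by elim: r => // k IH; rewrite -addn1 !natrD /= -IH.
Qed.

Lemma sum_rdet_gram (w : 'rV[H]_n) j :
  sum_rdet r (row_repl G j (w *m G)) j = d * (w *m P) 0 j.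
Proof.
rewrite sum_rdet_row_repl; last exact: gram_herm.
rewrite -mulmxA gram_adj_sum mulmxZr_real; first by rewrite [LHS]mxE.
exact: (det_sum_real gram_herm Ddet r).
Qed.

Lemma sum_cdet_gram (w : 'cV[H]_n) i :
  sum_cdet r (col_repl G i (G *m w)) i = d * (P *m w) i 0.
Proof.
have Gh : cadj G = G by rewrite cadjM cadjK.
have dr : qreal d := det_sum_real gram_herm Ddet r.
have Ph : cadj P = P by case: AX.
rewrite sum_cdetE cadj_col_repl cadjM Gh sum_rdet_gram qconjM dr.
by rewrite (qrealC _ dr) -{1}Ph -cadjM [cadj _ 0 i]mxE qconjK.
Qed.

End Gram.

Section GramTranspose.
Variables (R : realFieldType) (m n : nat).
Variables (A : 'M[quat R]_(m, n)) (X : 'M[quat R]_(n, m)).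

(** The projections attached to [A] and [cadj A] are [X *m A] and [A *m X], whose real traces
    agree. *)
Lemma det_rank_cadj r : is_MP_inverse A X -> det_rank A r -> det_rank (cadj A) r.
Proof.
move=> AX rA; have [r' rA'] := det_rank_exists (cadj A).
suff -> : r = r' by [].
apply/eqP; rewrite -(eqr_nat R) (det_rank_trace AX rA).
rewrite (det_rank_trace (is_MP_inverse_cadj AX) rA') -cadjM; case: AX => _ _ -> _.
apply/eqP; under eq_bigr do rewrite mxE q0_sum.
under [RHS]eq_bigr do rewrite mxE q0_sum.
rewrite exchange_big; apply: eq_bigr => i _; apply: eq_bigr => j _; exact: q0M.
Qed.

End GramTranspose.

(** * Determinantal formulas for the Moore-Penrose inverse *)

Section Two.
Variable R : realFieldType.
Local Notation H := (quat R).

Lemma quat2_unit : (2 : H) \is a GRing.unit.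
Proof.
suff: (2 : H) != 0 by [].
by apply/eqP => /(congr1 (@q0 R)) /= /eqP; rewrite (_ : 1 + 1 = 2%:R) // pnatr_eq0.
Qed.

Lemma mulq2C (x : H) : 2 * x = x * 2.
Proof. by rewrite mulr_natl mulr_natr. Qed.

Lemma qreal_inv2 : qreal (2^-1 : H).
Proof.
apply: (mulrI quat2_unit); rewrite mulrV ?quat2_unit // mulq2C.
have e : qconj 2 = 2 :> H by rewrite qconjD qconj1.
by rewrite -[X in _ * X = _]e -qconjM mulrV ?quat2_unit // qconj1.
Qed.

Lemma qdiv_real (a b x : H) : qreal a -> qreal b -> a != 0 -> b != 0 ->
  a * (b * x) / (2 * a * b) = 2^-1 * x.
Proof.
move=> ar br a0 b0.
have U : 2 * a * b \is a GRing.unit by rewrite unitrMr ?unitrMr ?quat2_unit.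
apply: (canLR (mulrK U)).
have -> : 2 * a * b = a * b * 2 by rewrite -mulrA mulq2C.
have er := qrealM ar br; rewrite mulrA; move: (a * b) er => e er.
by rewrite (qrealC x er) [RHS]mulrA -mulq2C !mulrA mulrV ?quat2_unit // mul1r.
Qed.

End Two.

Section MoorePenrose.
Variables (R : realFieldType) (m n r : nat).
Variables (A : 'M[quat R]_(m, n)) (X : 'M[quat R]_(n, m)).
Local Notation H := (quat R).
Hypothesis AX : is_MP_inverse A X.
Hypothesis rA : has_rank A r.
Let AA := cadj A *m A.
Let AAs := A *m cadj A.
Let den1 := sum_hdet r AA.
Let den2 := sum_hdet r AAs.
Let AAsE : AAs = cadj (cadj A) *m cadj A.
Proof. by rewrite cadjK. Qed.

Lemma den1_real : qreal den1.
Proof.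
rewrite /den1 (sum_hdetE (gram_herm A)).
exact: (det_sum_real (gram_herm A) (is_det_perm_det _)).
Qed.

Lemma den2_real : qreal den2.
Proof.
rewrite /den2 AAsE (sum_hdetE (gram_herm _)).
exact: (det_sum_real (gram_herm _) (is_det_perm_det _)).
Qed.

Lemma den1_neq0 : den1 != 0.
Proof.
rewrite /den1 (sum_hdetE (gram_herm A)).
exact: (has_rank_det_rank rA).2.
Qed.

Lemma den2_neq0 : den2 != 0.
Proof.
rewrite /den2 AAsE (sum_hdetE (gram_herm _)).
exact: (det_rank_cadj AX (has_rank_det_rank rA)).2.
Qed.

Lemma sum_cdet_MP (w : 'cV[H]_n) i :
  sum_cdet r (col_repl AA i (AA *m w)) i = den1 * (X *m A *m w) i 0.
Proof.
rewrite (sum_cdet_gram AX (has_rank_det_rank rA)) /den1.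
by rewrite (sum_hdetE (gram_herm A)).
Qed.

Lemma sum_rdet_MP (w : 'rV[H]_m) j :
  sum_rdet r (row_repl AAs j (w *m AAs)) j = den2 * (w *m (A *m X)) 0 j.
Proof.
rewrite /den2 AAsE (sum_rdet_gram (is_MP_inverse_cadj AX)
  (det_rank_cadj AX (has_rank_det_rank rA))).
have <- : cadj X *m cadj A = A *m X by rewrite -cadjM; case: AX.
by rewrite (sum_hdetE (gram_herm _)).
Qed.

End MoorePenrose.

Theorem theorem6p4 (R : realType) (m n r1 : nat)
  (A : 'M[quat R]_(m, n)) (B : 'M[quat R]_m) (Adag : 'M[quat R]_(n, m)) :
  has_rank A r1 -> is_MP_inverse A Adag ->
  let QA := A *m Adag in
  let X := Adag *m B *m (1%:M - (2^-1 : quat R) *: QA) in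
  let AA := cadj A *m A in
  let AAs := A *m cadj A in
  let B1 := cadj A *m B in
  let B2 := cadj A *m B *m A *m cadj A in
  let den1 := sum_hdet r1 AA in
  let den2 := sum_hdet r1 AAs in
  forall (i : 'I_n) (j : 'I_m),
  let d_i := \row_(k < m) sum_cdet r1 (col_repl AA i (col k B2)) i in
  let d_j := \col_(l < n) sum_rdet r1 (row_repl AAs j (row l B2)) j in
  X i j = sum_cdet r1 (col_repl AA i (col j B1)) i / den1
          - sum_rdet r1 (row_repl AAs j d_i) j / (2 * den1 * den2)
  /\
  X i j = sum_cdet r1 (col_repl AA i (col j B1)) i / den1
          - sum_cdet r1 (col_repl AA i d_j) i / (2 * den1 * den2).
Proof.
move=> rA AX QA X AA AAs B1 B2 den1 den2 i j d_i d_j.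
have [AXA XAX AXh XAh] := AX.
have r1' : qreal den1 := den1_real r1 A.
have r2' : qreal den2 := den2_real r1 A.
have n1 : den1 != 0 := den1_neq0 rA.
have n2 : den2 != 0 := den2_neq0 AX rA.
have GX : AA *m Adag = cadj A := gram_MP AX.
have QAs : QA *m AAs = AAs by rewrite /QA /AAs mulmxA AXA.
have QAQA : QA *m QA = QA by rewrite /QA mulmxA AXA.
(* [N] is the part of [X] subtracted with factor one half; introducing it by an equation keeps it
   opaque. *)
pose Z := Adag *m B; have [N NE] : {N | N = Z *m QA} by exists (Z *m QA).
have col_mul p q k (C : 'M[quat R]_(p, q)) (E : 'M[quat R]_(q, k)) a :
   col a (C *m E) = C *m col a E by rewrite !colE mulmxA.
(* As [cadj A = AA *m Adag], the column has the form [AA *m w]. A general [C] covers both [B1] and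
   the entries of [d_i]. *)
have first_term p (C : 'M[quat R]_(m, p)) k :
    sum_cdet r1 (col_repl AA i (col k (cadj A *m C))) i = den1 * (Adag *m C) i k.
  rewrite -GX -mulmxA col_mul (sum_cdet_MP AX rA) -col_mul mxE; congr (_ * _).
  by rewrite [in LHS]mulmxA XAX.
have XE : X i j = sum_cdet r1 (col_repl AA i (col j B1)) i / den1 - 2^-1 * N i j.
  rewrite first_term -/Z (qrealC _ r1') mulrK //.
  rewrite /X mulmxBr mulmx1 -/Z mxE [X in _ + X]mxE; congr (_ - _).
  rewrite mulmxZr_real; last exact: qreal_inv2.
  by rewrite -NE [LHS]mxE.
(* Inserting [QA] before [AAs] changes nothing, so [d_i] is a row times [AAs], as [sum_rdet_MP]
   requires. *)
have d_iE : d_i = (den1 *: row i N) *m AAs.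
  apply/rowP => k; rewrite [LHS]mxE /B2 -!mulmxA first_term -scalemxAl -row_mul.
  rewrite [RHS]mxE [row _ _ _ _]mxE; congr (_ * _).
  by rewrite NE -mulmxA QAs /Z !mulmxA.
have AAN : AA *m N = cadj A *m B *m QA by rewrite NE /Z !mulmxA GX.
(* Dually, [d_j] is [AA] times a column, as [sum_cdet_MP] requires. *)
have d_jE : d_j = AA *m (den2 *: col j N).
  have -> : AA *m (den2 *: col j N) = den2 *: col j (cadj A *m B *m QA).
    by rewrite mulmxZr_real // -col_mul AAN.
  apply/colP => l; rewrite [LHS]mxE.
  have -> : row l B2 = row l (cadj A *m B *m QA) *m AAs.
    by rewrite -row_mul -mulmxA QAs /B2 -!mulmxA.
  rewrite (sum_rdet_MP AX rA) -row_mul -/QA -mulmxA QAQA [RHS]mxE; congr (_ * _).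
  by rewrite [LHS]mxE [RHS]mxE.
have NQA : N *m QA = N by rewrite NE -mulmxA QAQA.
have PN : Adag *m A *m N = N by rewrite NE /Z !mulmxA XAX.
(* The second determinantal sum multiplies [N] by a projection that fixes it; [qdiv_real] then
   cancels the real factors [den1] and [den2]. *)
split; rewrite XE; congr (_ - _); rewrite -(qdiv_real (N i j) r1' r2' n1 n2).
  rewrite d_iE (sum_rdet_MP AX rA) -scalemxAl -row_mul -/QA NQA.
  rewrite [X in _ = _ * X / _]mxE [row _ _ _ _]mxE.
  by rewrite -/den2 !mulrA (qrealC _ r1').
rewrite d_jE (sum_cdet_MP AX rA) mulmxZr_real // -col_mul PN.
by rewrite [X in _ = _ * X / _]mxE [col _ _ _ _]mxE.
Qed.
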